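(* Let $k$ be an algebraically closed field of characteristic $p\neq 2$, and let $X$ be a complete non-singular non-hyperelliptic curve over $k$ of genus $g\geq 3$ whose canonical ideal $I_X\subset S=k[\omega_1,\ldots,\omega_g]$ is generated by the quadratic forms $\tilde{A}_1,\ldots,\tilde{A}_r$. Write $\tilde{A}_i=\bar{\omega}^t A_i\bar{\omega}$ with $A_i$ a symmetric $g\times g$ matrix over $k$ and $\bar{\omega}=(\omega_1,\ldots,\omega_g)^t$. Let $\sigma=(\sigma_{\mu,\nu})\in \mathrm{GL}_g(k)$. Then $\sigma$ gives rise to an automorphism of the curve $X$ if and only if there exist elements $\lambda(\sigma)_{ji}\in k$, $1\leq i,j\leq r$, such that $$\sigma(\tilde{A}_i)=\sum_{j=1}^r \lambda(\sigma)_{ji}\tilde{A}_j\qquad\text{for every } 1\leq i\leq r.$$ Moreover, since $\sigma$ acts on $\bar{\omega}$ by $\sigma(\bar{\omega})=(\sigma_{\mu,\nu})\bar{\omega}$, this condition can be written as $$(\sigma_{\mu,\nu})^t A_i(\sigma_{\mu,\nu})=\sum_{j=1}^r\lambda(\sigma)_{ji}A_j\qquad\text{for every }1\leq i\leq r.$$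
   Context: Let $\omega_1,\ldots,\omega_g$ be a basis of the space of holomorphic differentials $H^0(X,\Omega_X)$, and identify $\mathrm{Sym}\,H^0(X,\Omega_X)$ with the polynomial ring $S=k[\omega_1,\ldots,\omega_g]$. The canonical ideal $I_X$ is the kernel of the natural map $\mathrm{Sym}\,H^0(X,\Omega_X)\to\bigoplus_{n\geq 0}H^0(X,\Omega_X^{\otimes n})$; it is the homogeneous ideal of $X$ in its canonical embedding $X\hookrightarrow\mathbb{P}^{g-1}_k$. A matrix $\sigma\in\mathrm{GL}_g(k)$ acts on $S$ as the $k$-algebra automorphism determined by $\sigma(\bar{\omega})=(\sigma_{\mu,\nu})\bar{\omega}$ (that is, $\sigma(\omega_\mu)=\sum_\nu\sigma_{\mu,\nu}\omega_\nu$). We say that $\sigma$ gives rise to an automorphism of $X$ if the automorphism of $\mathbb{P}^{g-1}_k$ it induces restricts to an automorphism of the canonically embedded curve $X$. *)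

(* Defs.v *)
From HB Require Import structures.
From mathcomp Require Import all_boot all_order all_algebra.
From mathcomp Require Import mpoly.

Set Implicit Arguments.
Unset Strict Implicit.
Unset Printing Implicit Defensive.

Import GRing.Theory.
Local Open Scope ring_scope.

(* A complete non-singular curve X over the algebraically closed field k is
   given by its function field K/k, with structure morphism iota : k -> K
   (there are no schemes in the libraries).  The closed points of X are the
   valuation rings of K/k, the stalk at a point being the valuation ring
   itself; every complete non-singular curve arises in this way from its
   function field. *)

Section FunctionField.

Variables (k K : fieldType) (iota : {rmorphism k -> K}).

Definition in_simple_ext (x z : K) : Prop :=
  exists p q : {poly k},
    (map_poly iota q).[x] != 0 /\
    z = (map_poly iota p).[x] / (map_poly iota q).[x].

Definition transcendental (x : K) : Prop :=
  forall p : {poly k}, root (map_poly iota p) x -> p = 0.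

(* [K : k(x)] = n. *)
Definition degree_over (x : K) (n : nat) : Prop :=
  exists b : 'I_n -> K, forall z : K,
    exists! c : {ffun 'I_n -> K},
      (forall i, in_simple_ext x (c i)) /\ z = \sum_(i < n) c i * b i.

Definition function_field : Prop :=
  exists x : K, transcendental x /\ exists n : nat, degree_over x n.

(* A non-constant x in K is the same thing as a finite morphism X -> P^1, and
   its degree is [K : k(x)].  This is used for curves of genus at least 2. *)
Definition hyperelliptic : Prop :=
  exists x : K, transcendental x /\ degree_over x 2.

(* Valuation rings O of K/k with O <> K.  When K/k is a function field in one
   variable they are automatically discrete, with residue field k. *)
Definition is_point (O : K -> Prop) : Prop :=
  [/\ forall c : k, O (iota c),
      forall x y, O x -> O y -> O (x - y) /\ O (x * y),
      forall x, O x \/ O x^-1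
    & exists x, ~ O x].

Definition in_maximal_ideal (O : K -> Prop) (x : K) : Prop :=
  O x /\ (x = 0 \/ ~ O x^-1).

(* x is regular at the point O and takes the value c there. *)
Definition has_value (O : K -> Prop) (x : K) (c : k) : Prop :=
  in_maximal_ideal O (x - iota c).

Definition is_derivation (M : lmodType K) (d : K -> M) : Prop :=
  [/\ forall x y, d (x + y) = d x + d y,
      forall x y, d (x * y) = x *: d y + y *: d x
    & forall c : k, d (iota c) = 0].

(* (Omega, d) is the module of Kaehler differentials of K/k. *)
Definition is_kaehler (Omega : lmodType K) (d : K -> Omega) : Prop :=
  is_derivation d /\
  forall (M : lmodType K) (delta : K -> M), is_derivation delta ->
    (exists f : {linear Omega -> M}, forall x, f (d x) = delta x) /\
    (forall f f' : {linear Omega -> M},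
       (forall x, f (d x) = f' (d x)) -> f =1 f').

Section Differentials.

Variables (Omega : lmodType K) (d : K -> Omega).

(* The stalk of Omega_X at O is the image of Omega_(O/k) in Omega_(K/k). *)
Definition regular_differential_at (O : K -> Prop) (w : Omega) : Prop :=
  exists (n : nat) (a b : 'I_n -> K),
    (forall i, O (a i) /\ O (b i)) /\ w = \sum_(i < n) a i *: d (b i).

(* w belongs to H^0(X, Omega_X). *)
Definition holomorphic (w : Omega) : Prop :=
  forall O, is_point O -> regular_differential_at O w.

(* In particular g = dim_k H^0(X, Omega_X) is the genus of X. *)
Definition holomorphic_basis (g : nat) (w : 'I_g -> Omega) : Prop :=
  [/\ forall i, holomorphic (w i),
      forall v, holomorphic v ->
        exists c : 'I_g -> k, v = \sum_(i < g) iota (c i) *: w i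
    & forall c : 'I_g -> k,
        \sum_(i < g) iota (c i) *: w i = 0 -> forall i, c i = 0].

(* The natural map is a map to the sum over n of the H^0(X, Omega_X^n), which
   is a subring of the sum over n of the n-th tensor powers of Omega_(K/k).
   As Omega_(K/k) is a line over K, any generator eta identifies the latter
   ring with {poly K}, the element h *: eta^n corresponding to h *: 'X^n.
   The kernel does not depend on eta. *)
Definition canonical_ideal (g : nat) (w : 'I_g -> Omega)
    (F : {mpoly k[g]}) : Prop :=
  exists (eta : Omega) (f : 'I_g -> K),
    [/\ eta != 0,
        forall i, w i = f i *: eta
      & mmap (polyC \o iota) (fun i => f i *: 'X) F = 0].

(* Subsets of P^(g-1) are given by the nonzero vectors of homogeneous
   coordinates of their points.  The image of the point O under the canonical
   map is (w_1 : ... : w_g) evaluated at O, after division by an eta for which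
   the w_i / eta are regular at O and do not all vanish there. *)
Definition canonical_curve (g : nat) (w : 'I_g -> Omega) (a : 'cV[k]_g) : Prop :=
  a != 0 /\
  exists O : K -> Prop, is_point O /\
  exists (eta : Omega) (h : 'I_g -> K),
    forall i, w i = h i *: eta /\ has_value O (h i) (a i 0).

End Differentials.
End FunctionField.

Section Projective.

Variables (k : fieldType) (g : nat).

Definition same_point (a b : 'cV[k]_g) : Prop :=
  exists2 c : k, c != 0 & a = c *: b.

Definition eval_forms (F : 'I_g -> {mpoly k[g]}) (a : 'cV[k]_g) : 'cV[k]_g :=
  \col_i (F i).@[fun j => a j 0].

(* f, given on homogeneous coordinates, is a morphism from Y to Z: locally on
   Y it is given by forms of the same degree without common zero. *)
Definition projective_morphism (Y Z : 'cV[k]_g -> Prop)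
    (f : 'cV[k]_g -> 'cV[k]_g) : Prop :=
  forall a, Y a -> Z (f a) /\
    exists (e : nat) (F : 'I_g -> {mpoly k[g]}),
      [/\ forall i, F i \is e.-homog,
          eval_forms F a != 0
        & forall b, Y b -> eval_forms F b != 0 ->
            same_point (f b) (eval_forms F b)].

Definition projective_automorphism (Y : 'cV[k]_g -> Prop)
    (f : 'cV[k]_g -> 'cV[k]_g) : Prop :=
  projective_morphism Y Y f /\
  exists h : 'cV[k]_g -> 'cV[k]_g,
    projective_morphism Y Y h /\
    forall a, Y a -> same_point (h (f a)) a /\ same_point (f (h a)) a.

Definition quadratic_form (A : 'M[k]_g) : {mpoly k[g]} :=
  \sum_(mu < g) \sum_(nu < g) A mu nu *: ('X_mu * 'X_nu).

Definition linear_action (s : 'M[k]_g) (F : {mpoly k[g]}) : {mpoly k[g]} :=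
  F \mPo [tuple \sum_(nu < g) s mu nu *: 'X_nu | mu < g].

Definition generated_by (r : nat) (G : 'I_r -> {mpoly k[g]})
    (F : {mpoly k[g]}) : Prop :=
  exists c : 'I_r -> {mpoly k[g]}, F = \sum_(i < r) c i * G i.

End Projective.

(* The automorphism of P^(g-1) with comorphism linear_action s sends the point
   with coordinate vector a to s *m a. *)
Definition gives_automorphism (k K : fieldType) (iota : {rmorphism k -> K})
    (Omega : lmodType K) (g : nat) (w : 'I_g -> Omega) (s : 'M[k]_g) : Prop :=
  projective_automorphism (canonical_curve iota w) (fun a => s *m a).

(* Main.v *)
Require Import Defs.
From HB Require Import structures.
From mathcomp Require Import all_boot all_order all_algebra.
From mathcomp Require Import mpoly.
From mathcomp Require boolp classical_sets.
From mathcomp Require Import ring.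

(* The canonical curve is the zero locus of the quadrics.  If [a] is a zero of
   the homogeneous ideal, evaluation at [a] is a well-defined map to [k] on the
   ring of the quotients [F(w) / w_i0^e], and a homomorphism from a subring of
   [K] to the algebraically closed field [k] extends to a valuation ring.  So a
   linear map which preserves the span of the quadrics, hence (by dimension)
   induces a bijection of it, acts on the curve with its inverse.

   Conversely, a form [F] vanishing on the curve lies in the ideal: otherwise
   there is a point, over a value [c] of a transcendental [x] avoiding finitely
   many denominators, where the [w_i / w_i0] and [1 / F(w / w_i0)] are regular.
   Apply this to the transforms of the quadrics and compare degree 2 parts. *)

Set Implicit Arguments.
Unset Strict Implicit.
Unset Printing Implicit Defensive.

Import GRing.Theory.
Local Open Scope ring_scope.

Section Places.

Variables (k K : fieldType) (iota : {rmorphism k -> K}).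

(* The graph of a homomorphism of [k]-algebras from a subring of [K] to [k]. *)
Definition partial_place (G : K * k -> Prop) : Prop :=
  [/\ forall c, G (iota c, c),
      forall u v, G u -> G v -> G (u - v) /\ G (u * v)
    & ~ G (0, 1)].

Definition coef_in (G : K * k -> Prop) (P : {poly K}) (Q : {poly k}) : Prop :=
  forall i, G (P`_i, Q`_i).

Section PartialPlace.

Variables (G : K * k -> Prop) (hG : partial_place G).

Lemma pplaceC c : G (iota c, c).
Proof. by case: hG. Qed.

Lemma pplaceB x y a b : G (x, a) -> G (y, b) -> G (x - y, a - b).
Proof. by case: hG => _ h _ Gx Gy; case: (h _ _ Gx Gy). Qed.

Lemma pplaceM x y a b : G (x, a) -> G (y, b) -> G (x * y, a * b).
Proof. by case: hG => _ h _ Gx Gy; case: (h _ _ Gx Gy). Qed.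

Lemma pplace01 : ~ G (0, 1).
Proof. by case: hG. Qed.

Lemma pplace0 : G (0, 0).
Proof. by have := pplaceC 0; rewrite rmorph0. Qed.

Lemma pplace1 : G (1, 1).
Proof. by have := pplaceC 1; rewrite rmorph1. Qed.

Lemma pplaceD x y a b : G (x, a) -> G (y, b) -> G (x + y, a + b).
Proof.
move=> Gx Gy; rewrite -[y]opprK -[b]opprK; apply: pplaceB Gx _.
by rewrite -[- y]add0r -[- b]add0r; apply: pplaceB Gy; apply: pplace0.
Qed.

Lemma pplace_sum (I : Type) (r : seq I) (F : I -> K) (E : I -> k) :
  (forall i, G (F i, E i)) -> G (\sum_(i <- r) F i, \sum_(i <- r) E i).
Proof.
move=> GFE; apply: (big_ind2 (fun x a => G (x, a))) => // [|x a y b].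
  exact: pplace0.
exact: pplaceD.
Qed.

Lemma pplaceX x a n : G (x, a) -> G (x ^+ n, a ^+ n).
Proof.
move=> Gx; elim: n => [|n IHn]; first exact: pplace1.
by rewrite !exprS; apply: pplaceM.
Qed.

Lemma pplace_val0 x a : G (x, a) -> x = 0 -> a = 0.
Proof.
move=> Gx x0; apply/eqP/negPn/negP => a0; apply: pplace01.
by rewrite -(mulVf a0) -(mulr0 (iota a^-1)) -x0; apply: pplaceM Gx; apply: pplaceC.
Qed.

Lemma coef_in_map q : coef_in G (map_poly iota q) q.
Proof. by move=> i; rewrite coef_map; apply: pplaceC. Qed.

Lemma coef_inB P Q P' Q' :
  coef_in G P Q -> coef_in G P' Q' -> coef_in G (P - P') (Q - Q').
Proof. by move=> h h' i; rewrite !coefB; apply: pplaceB. Qed.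

Lemma coef_inM P Q P' Q' :
  coef_in G P Q -> coef_in G P' Q' -> coef_in G (P * P') (Q * Q').
Proof. by move=> h h' i; rewrite !coefM; apply: pplace_sum => j; apply: pplaceM. Qed.

(* Infinite descent: subtracting from the longer relation a multiple of the
   shorter one, times a power of [y], shortens the longer one. *)
Lemma no_inverse_relations (y : K) (P R : {poly K}) :
  y != 0 -> coef_in G P 1 -> coef_in G R 1 ->
  P.[y] = 0 -> R.[y^-1] = 0 -> False.
Proof.
have [N] := ubnP (size P + size R).
elim: N => // N IHN in y P R *; rewrite ltnS => sPR y0 GP GR Py Ry.
wlog sRP : y P R sPR y0 GP GR Py Ry / (size R <= size P)%N.
  move=> h; case: (leqP (size R) (size P)) => [|/ltnW] sz; first exact: (h y P R).
  by apply: (h y^-1 R P) => //; rewrite ?invr_eq0 ?invrK // addnC.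
case sP: (size P) => [|[|n]].
- have /eqP := sP; rewrite size_poly_eq0 => /eqP P0.
  by apply: pplace01; have := GP 0; rewrite P0 coef0 coefC.
- have [c c0 Pc] := size_poly1P _ (introT eqP sP).
  by move: Py; rewrite Pc hornerC => c00; rewrite c00 eqxx in c0.
pose S := \poly_(i < n.+2) R`_(n.+1 - i).
have Sy : S.[y] = 0.
  transitivity (y ^+ n.+1 * R.[y^-1]); last by rewrite Ry mulr0.
  rewrite horner_poly.
  rewrite (@horner_coef_wide _ n.+2 R) -1?sP // sP mulr_sumr.
  rewrite (reindex_inj rev_ord_inj) /=. apply: eq_bigr => i _.
  have lin : (i <= n.+1)%N by rewrite -ltnS.
  by rewrite subSS subKn // mulrCA exprVn expfB_cond // (negPf y0).
pose P' : {poly K} := R`_0 *: P - P`_n.+1 *: S.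
have GP' : coef_in G P' 1.
  move=> i; rewrite coefB !coefZ coef_poly.
  have -> : (1 : {poly k})`_i = 1 * (1 : {poly k})`_i - 0 * (i == n.+1)%:R.
    by rewrite mul1r mul0r subr0.
  apply: pplaceB; apply: pplaceM => //.
  + by have := GR 0; rewrite coef1.
  + by have := GP n.+1; rewrite coef1.
  case: ltnP => [|lni]; last by rewrite gtn_eqF //; apply: pplace0.
  rewrite ltnS => lin; have := GR (n.+1 - i)%N; rewrite coef1 subn_eq0.
  by rewrite eqn_leq lin.
have sP' : (size P' < size P)%N.
  rewrite sP ltnS; apply/leq_sizeP => j.
  rewrite coefB !coefZ coef_poly leq_eqVlt => /predU1P[<-|lnj].
    by rewrite ltnS leqnn subnn mulrC subrr.
  by rewrite ltnNge lnj mulr0 subr0 [P`_j]nth_default ?mulr0 // sP.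
apply: (IHN y P' R) => //; last by rewrite hornerD hornerN !hornerZ Py Sy !mulr0 subr0.
by apply: leq_trans sPR; rewrite ltn_add2r.
Qed.

Definition adjoin (y : K) (c : k) (z : K * k) : Prop :=
  exists P Q, coef_in G P Q /\ z = (P.[y], Q.[c]).

Lemma adjoin_sub y c z : G z -> adjoin y c z.
Proof.
case: z => x a Gx; exists x%:P, a%:P; split; last by rewrite !hornerC.
by move=> i; rewrite !coefC; case: eqP => _ //; apply: pplace0.
Qed.

Lemma adjoin_gen y c : adjoin y c (y, c).
Proof.
exists 'X, 'X; split; last by rewrite !hornerX.
by move=> i; rewrite !coefX; case: eqP => _; [apply: pplace1|apply: pplace0].
Qed.

Lemma adjoin_pplace y c : ~ adjoin y c (0, 1) -> partial_place (adjoin y c).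
Proof.
move=> n01; split=> // [b|_ _ [P [Q [PQ ->]]] [P' [Q' [PQ' ->]]]].
  by apply: adjoin_sub; apply: pplaceC.
split; [exists (P - P'), (Q - Q')|exists (P * P'), (Q * Q')]; split.
- exact: coef_inB.
- by rewrite !hornerD !hornerN.
- exact: coef_inM.
- by rewrite !hornerM.
Qed.

End PartialPlace.

Lemma pointD (O : K -> Prop) (x y : K) : is_point iota O -> O x -> O y -> O (x + y).
Proof.
case=> OC OBM _ _ Ox Oy; rewrite -[y]opprK; apply: (OBM _ _ Ox _).1.
by rewrite -sub0r; apply: (OBM _ _ _ Oy).1; rewrite -(rmorph0 iota).
Qed.

Lemma has_value_pplace (O : K -> Prop) :
  is_point iota O -> partial_place (fun z => has_value iota O z.1 z.2).
Proof.
move=> hO; have [OC OBM OV [t Ot]] := hO.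
have O0 : O 0 by rewrite -(rmorph0 iota).
have O1 : O 1 by rewrite -(rmorph1 iota).
have ON x : O x -> O (- x) by move=> Ox; rewrite -sub0r; case: (OBM _ _ O0 Ox).
have OM x y : O x -> O y -> O (x * y) by move=> Ox Oy; case: (OBM _ _ Ox Oy).
pose m := in_maximal_ideal O.
have m0 : m 0 by split=> //; left.
have mM x y : m x -> O y -> m (x * y).
  move=> [Ox [-> | nOx]] Oy; first by rewrite mul0r.
  split; first exact: OM.
  have [->|y0] := eqVneq y 0; first by left; rewrite mulr0.
  have [->|x0] := eqVneq x 0; first by left; rewrite mul0r.
  by right=> Oxy; apply: nOx; rewrite -[x^-1]mulr1 -(mulfV y0) mulrCA -invfM; apply: OM.
have mD x y : m x -> m y -> m (x + y).
  have [->|x0] := eqVneq x 0; first by rewrite add0r.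
  have [->|y0] := eqVneq y 0; first by rewrite addr0.
  move=> mx my; case: (OV (x / y)) => [Oxy|].
    have -> : x + y = y * (x / y + 1) by field.
    by apply: mM => //; apply: pointD hO _ O1.
  rewrite invf_div => Oyx.
  have -> : x + y = x * (y / x + 1) by field.
  by apply: mM => //; apply: pointD hO _ O1.
have mN x : m x -> m (- x) by move=> mx; rewrite -mulrN1; apply: mM => //; apply: ON.
split=> [c|[x a] [y b] /= mx my|/=].
- by rewrite /has_value /= subrr.
- have Oy : O y.
    by rewrite -[y](subrK (iota b)); apply: (pointD hO); [case: my|apply: OC].
  split; rewrite /has_value ?rmorphB ?rmorphM.
    have -> : x - y - (iota a - iota b) = (x - iota a) - (y - iota b) by ring.
    by apply: mD => //; apply: mN.
  have -> : x * y - iota a * iota b = (x - iota a) * y + (y - iota b) * iota a by ring.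
  by apply: mD; apply: mM.
- rewrite /has_value rmorph1 sub0r => -[_ []] => [/eqP|].
    by rewrite oppr_eq0 oner_eq0.
  by rewrite invrN invr1; apply; apply: ON.
Qed.

End Places.

Lemma closed_poly_ideal1 (k : closedFieldType) (J : {poly k} -> Prop) :
  (forall p q, J p -> J q -> J (p - q)) -> (forall p q, J p -> J (q * p)) ->
  (forall c, exists2 p, J p & p.[c] != 0) -> J 1.
Proof.
move=> JB JM Jc; have [p Jp p0] := Jc 0.
have {p0} : p != 0 by apply: contraNneq p0 => ->; rewrite horner0.
have [n] := ubnP (size p); elim: n => // n IHn in p Jp *; rewrite ltnS => sp p0.
have [/size_poly1P[a a0 pE]|/closed_rootP[c pc]] := boolP (size p == 1%N).
  have -> : 1 = a^-1%:P * p by rewrite pE -polyCM mulVf.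
  exact: JM.
have [q Jq qc] := Jc c; apply: (IHn (q %% p)).
- have -> : q %% p = q - q %/ p * p by rewrite {2}(divp_eq q p) addrC addKr.
  by apply: JB => //; apply: JM.
- by apply: leq_trans sp; rewrite ltn_modp.
- apply: contraNneq qc => qp.
  by rewrite (divp_eq q p) qp addr0 hornerM (rootP pc) mulr0.
Qed.

Section Extension.

Variables (k : closedFieldType) (K : fieldType) (iota : {rmorphism k -> K}).

Lemma maximal_pplace_total (G : K * k -> Prop) :
  partial_place iota G ->
  (forall H : K * k -> Prop, partial_place iota H -> (forall z, G z -> H z) ->
     forall z, H z -> G z) ->
  forall y, (exists c, G (y, c)) \/ (exists c, G (y^-1, c)).
Proof.
move=> hG Gmax.
have relation y : ~ (exists c, G (y, c)) ->
    exists2 P : {poly K}, coef_in G P 1 & P.[y] = 0.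
  move=> ny; pose J (Q : {poly k}) := exists2 P : {poly K}, coef_in G P Q & P.[y] = 0.
  apply: (@closed_poly_ideal1 k J) => [Q Q' [P PQ Py] [P' PQ' Py']|Q q [P PQ Py]|c].
  - exists (P - P'); first exact: (coef_inB hG).
    by rewrite hornerD hornerN Py Py' subr0.
  - exists (map_poly iota q * P); last by rewrite hornerM Py mulr0.
    by apply: (coef_inM hG) => //; apply: coef_in_map.
  - case: (boolp.pselect (adjoin G y c (0, 1))) => [|n01].
      case=> P [Q [PQ [Py Qc]]]; exists Q; last by rewrite -Qc oner_eq0.
      by exists P.
    case: ny; exists c; apply: (Gmax _ (adjoin_pplace hG n01)).
      by move=> z; apply: (adjoin_sub hG).
    exact: (adjoin_gen hG).
move=> y; have [->|y0] := eqVneq y 0; first by left; exists 0; apply: (pplace0 hG).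
case: (boolp.pselect (exists c, G (y, c))) => [|/relation[P GP Py]]; first by left.
case: (boolp.pselect (exists c, G (y^-1, c))) => [|/relation[R GR Ry]]; first by right.
by case: (no_inverse_relations hG y0 GP GR Py Ry).
Qed.

Lemma maximal_pplace_exists (G0 : K * k -> Prop) :
  partial_place iota G0 ->
  exists G, [/\ partial_place iota G, forall z, G0 z -> G z &
    forall H : K * k -> Prop, partial_place iota H -> (forall z, G z -> H z) ->
      forall z, H z -> G z].
Proof.
move=> hG0.
pose good (G : K * k -> Prop) := partial_place iota G /\ forall z, G0 z -> G z.
have [|G [[G_0|[hG G0G]] Gmax]] :=
    @classical_sets.Zorn_bigcup _ (fun G => (forall z, ~ G z) \/ good G).
- move=> F FP Ftot.
  case: (boolp.pselect (exists2 X, F X & good X)) => [[X FX gX]|nX]; last first.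
    left=> z [X FX Xz]; case: (FP _ FX) => [nXz|gX]; first exact: (nXz z).
    by apply: nX; exists X.
  have FU x : (classical_sets.bigcup F id) x -> exists2 Y, F Y & good Y /\ Y x.
    case=> Y FY Yx; exists Y => //; split=> //.
    by case: (FP _ FY) => // nY; case: (nY x).
  right; split; last by move=> z G0z; exists X => //; apply: gX.2.
  split=> [c|u v /FU[Y FY [gY Yu]] /FU[Z FZ [gZ Zv]]|/FU[Y _ [[hY _] Y01]]].
  + by exists X => //; apply: pplaceC gX.1 _.
  + case: (Ftot _ _ FY FZ) => sub.
      by case: gZ => -[_ h _] _; case: (h u v (sub _ Yu) Zv); split; exists Z.
    by case: gY => -[_ h _] _; case: (h u v Yu (sub _ Zv)); split; exists Y.
  + exact: pplace01 hY Y01.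
- case: (Gmax G0).
    split=> [z Gz|sub]; first by case: (G_0 z).
    by apply: (G_0 (0, 0)); apply: sub; apply: pplace0 hG0.
  by right; split.
- exists G; split=> // H hH GH z Hz.
  apply: boolp.contrapT => nGz; apply: (Gmax H).
    by split=> // sub; apply: nGz; apply: sub.
  by right; split=> // u /G0G/GH.
Qed.

Lemma point_extending (G0 : K * k -> Prop) (t : K) :
  partial_place iota G0 -> t != 0 -> G0 (t, 0) ->
  exists O, [/\ is_point iota O,
    forall z c, G0 (z, c) -> has_value iota O z c
    & forall z, O z -> exists c, has_value iota O z c].
Proof.
move=> hG0 t0 G0t; have [G [hG G0G Gmax]] := maximal_pplace_exists hG0.
pose O z := exists c, G (z, c).
have inv_notin x : x != 0 -> G (x, 0) -> ~ O x^-1.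
  move=> x0 Gx [c Gxc]; apply: (pplace01 hG).
  have := pplaceB hG (pplace1 hG) (pplaceM hG Gx Gxc).
  by rewrite divff // subrr mul0r subr0.
have value z c : G (z, c) -> has_value iota O z c.
  move=> Gz; have Gzc : G (z - iota c, 0).
    by rewrite -(subrr c); apply: (pplaceB hG) Gz (pplaceC hG c).
  split; first by exists 0.
  by have [->|zc] := eqVneq (z - iota c) 0; [left|right; apply: inv_notin].
exists O; split=> [|z c /G0G|z [c Gz]]; [|exact: value|by exists c; apply: value].
split=> [c|x y [a Gx] [b Gy]|x|]; first by exists c; apply: (pplaceC hG).
- by split; [exists (a - b); apply: (pplaceB hG)|exists (a * b); apply: (pplaceM hG)].
- exact: maximal_pplace_total.
- by exists t^-1; apply: inv_notin => //; apply: G0G.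
Qed.

End Extension.

Section Denominators.

Variables (k K : fieldType) (iota : {rmorphism k -> K}).

Lemma point_ratio_bound (O : K -> Prop) (I : finType) (f : I -> K) (i1 : I) :
  is_point iota O -> f i1 != 0 ->
  exists2 i0, f i0 != 0 & forall j, O (f j / f i0).
Proof.
case=> OC OBM OV _ fi1.
suff [i0 fi0 h] : exists2 i0, f i0 != 0 & {in enum I, forall j, O (f j / f i0)}.
  by exists i0 => // j; apply: h; rewrite mem_enum.
elim: (enum I) => [|j s [i fi IHs]]; first by exists i1.
case: (OV (f j / f i)) => [Oji|].
  by exists i => // l /predU1P[->|/IHs].
have [fj _|fj] := eqVneq (f j) 0.
  by exists i => // l /predU1P[->|/IHs //]; rewrite fj mul0r -(rmorph0 iota).
rewrite invf_div => Oij; exists j => // l /predU1P[->|/IHs Oli].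
  by rewrite divff // -(rmorph1 iota).
have -> : f l / f j = f l / f i * (f i / f j) by rewrite mulrA divfK.
by case: (OBM _ _ Oli Oij).
Qed.

Lemma point_denominator (x : K) (n : nat) (z : K) :
  degree_over iota x n ->
  exists Q : {poly k}, Q != 0 /\ forall (c : k) (O : K -> Prop),
    is_point iota O ->
    (forall p q : {poly k}, q.[c] != 0 ->
       O ((map_poly iota p).[x] / (map_poly iota q).[x])) ->
    Q.[c] != 0 -> O z.
Proof.
case=> b hb.
have /boolp.choice[M hM] i : exists M : 'I_n -> K,
    (forall j, in_simple_ext iota x (M j)) /\ z * b i = \sum_j M j * b j.
  by have [M [hM _]] := hb (z * b i); exists M.
have /boolp.choice[p hp] (ij : 'I_n * 'I_n) : exists p : {poly k} * {poly k},
    (map_poly iota p.2).[x] != 0 /\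
    M ij.1 ij.2 = (map_poly iota p.1).[x] / (map_poly iota p.2).[x].
  by have [p [q pq]] := (hM ij.1).1 ij.2; exists (p, q).
exists (\prod_ij (p ij).2); split=> [|c O hO Oreg].
  apply/prodf_neq0 => ij _; have [+ _] := hp ij.
  by apply: contraNneq => ->; rewrite rmorph0 horner0.
rewrite horner_prod => /prodf_neq0 Qc.
have [i1 bi1] : exists i, b i != 0.
  apply: boolp.contrapT => nb; have [c1 [[_ c1E] _]] := hb 1.
  have /eqP[] := oner_neq0 K; rewrite c1E big1 // => i _.
  by case: (eqVneq (b i) 0) => [->|bi]; [rewrite mulr0|case: nb; exists i].
have [i0 bi0 Ob] := point_ratio_bound hO bi1.
have [OC OBM _ _] := hO.
have O0 : O 0 by rewrite -(rmorph0 iota).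
have -> : z = \sum_j M i0 j * (b j / b i0).
  rewrite -[z](mulfK bi0) (hM i0).2 mulr_suml.
  by apply: eq_bigr => j _; rewrite mulrA.
apply: (big_ind O) => // [u v Ou Ov|j _].
  exact: pointD hO Ou Ov.
have [_ ->] := hp (i0, j).
by case: (OBM _ _ (Oreg (p (i0, j)).1 _ (Qc (i0, j) isT)) (Ob j)).
Qed.

End Denominators.

Lemma regular_point (k : closedFieldType) (K : fieldType)
    (iota : {rmorphism k -> K}) (I : finType) (y : I -> K) :
  function_field iota ->
  exists O, [/\ is_point iota O, forall i, O (y i)
    & forall z, O z -> exists c, has_value iota O z c].
Proof.
case=> x [trx [n degx]].
have /boolp.choice[Q hQ] i := point_denominator (y i) degx.
have /closed_nonrootP[c] : \prod_i Q i != 0 by apply/prodf_neq0 => i _; apply: (hQ i).1.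
rewrite rootE horner_prod => /prodf_neq0 Qc.
have ev0 q : q.[c] != 0 -> (map_poly iota q).[x] != 0.
  move=> qc; apply: contraNneq qc => qx.
  by rewrite (trx q) ?horner0 //; apply/eqP.
pose G0 z := exists p q : {poly k}, q.[c] != 0 /\
  z = ((map_poly iota p).[x] / (map_poly iota q).[x], p.[c] / q.[c]).
have hG0 : partial_place iota G0.
  split=> [b|_ _ [p [q [qc ->]]] [p' [q' [qc' ->]]]|[p [q [qc [px pc]]]]].
  - by exists b%:P, 1; rewrite map_polyC rmorph1 !hornerC !divr1 oner_neq0.
  - have := ev0 _ qc; have := ev0 _ qc' => qx' qx.
    split.
      exists (p * q' - p' * q), (q * q'); rewrite rmorphB !rmorphM /=.
      rewrite !(hornerM, hornerD, hornerN) mulf_neq0 //; split=> //.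
      by congr pair => /=; field; rewrite ?qx ?qx' ?qc ?qc'.
    exists (p * p'), (q * q'); rewrite !rmorphM /= !hornerM mulf_neq0 //; split=> //.
    by congr pair => /=; field; rewrite ?qx ?qx' ?qc ?qc'.
  - have p0 : p = 0.
      apply: trx; have /esym/eqP := px.
      by rewrite mulf_eq0 invr_eq0 (negPf (ev0 _ qc)) orbF.
    by move: pc; rewrite p0 horner0 mul0r => /eqP; rewrite oner_eq0.
have xc : x - iota c != 0.
  apply/eqP => xc; have := trx ('X - c%:P); rewrite rmorphB /= map_polyX map_polyC /=.
  by rewrite rootE !hornerE xc => /(_ (eqxx _)) /eqP; rewrite polyXsubC_eq0.
have G0xc : G0 (x - iota c, 0).
  exists ('X - c%:P), 1; rewrite rmorphB /= map_polyX map_polyC /= rmorph1.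
  by rewrite !hornerE oner_neq0 subrr mul0r divr1.
have [O [hO G0O vO]] := point_extending hG0 xc G0xc.
exists O; split=> // i; apply: (hQ i).2 (Qc i isT) => // p q qc.
have [+ _] := G0O ((map_poly iota p).[x] / (map_poly iota q).[x]) (p.[c] / q.[c])
  (ex_intro _ p (ex_intro _ q (conj qc erefl))).
move=> Osub; rewrite -[_ / _](subrK (iota (p.[c] / q.[c]))).
by apply: (pointD hO Osub); case: hO.
Qed.

Section Evaluation.

Variable (g : nat).

Lemma pplace_mmap (k K : fieldType) (iota : {rmorphism k -> K}) (G : K * k -> Prop)
    (h : 'I_g -> K) (a : 'I_g -> k) (F : {mpoly k[g]}) :
  partial_place iota G -> (forall i, G (h i, a i)) -> G (mmap iota h F, F.@[a]).
Proof.
move=> hG Gh; apply: (pplace_sum hG) => m; apply: (pplaceM hG); first exact: (pplaceC hG).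
apply: (big_ind2 (fun x c => G (x, c))) => // [|x c y b|i _].
- exact: (pplace1 hG).
- exact: (pplaceM hG).
- exact: (pplaceX hG).
Qed.

Lemma mmap_homog_scale (k : ringType) (R : comRingType) (phi : k -> R) (t : R)
    (h : 'I_g -> R) (e : nat) (F : {mpoly k[g]}) :
  F \is e.-homog -> mmap phi (fun i => t * h i) F = t ^+ e * mmap phi h F.
Proof.
move=> /dhomogP hF; rewrite /mmap mulr_sumr; apply: eq_big_seq => m /hF <-.
rewrite mulrCA; congr (_ * _); rewrite /mmap1 /= mdegE -prodrXr -big_split /=.
by apply: eq_bigr => i _; rewrite exprMn.
Qed.

Lemma mmap_polyC (k R : comRingType) (phi : k -> R) (h : 'I_g -> R) (F : {mpoly k[g]}) :
  mmap (polyC \o phi) (fun i => (h i)%:P) F = (mmap phi h F)%:P.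
Proof.
rewrite /mmap rmorph_sum; apply: eq_bigr => m _; rewrite rmorphM rmorph_prod /=.
by congr (_ * _); apply: eq_bigr => i _; rewrite rmorphXn.
Qed.

Lemma mmap_homogX (k R : comRingType) (phi : k -> R) (h : 'I_g -> R) (e : nat)
    (F : {mpoly k[g]}) :
  F \is e.-homog ->
  mmap (polyC \o phi) (fun i => h i *: 'X) F = mmap phi h F *: 'X^e.
Proof.
move=> hF; transitivity (mmap (polyC \o phi) (fun i => 'X * (h i)%:P) F).
  by apply: eq_bigr => m _; congr (_ * _); apply: mmap1_eq => i; rewrite mulrC mul_polyC.
by rewrite (mmap_homog_scale _ _ _ hF) mmap_polyC mulrC mul_polyC.
Qed.

End Evaluation.

Section CanonicalCurve.

Variables (k : closedFieldType) (K : fieldType) (iota : {rmorphism k -> K}).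
Variables (Omega : lmodType K) (g : nat) (w : 'I_g -> Omega).
Hypothesis w_free :
  forall c : 'I_g -> k, \sum_(i < g) iota (c i) *: w i = 0 -> forall i, c i = 0.
Variables (eta : Omega) (f : 'I_g -> K).
Hypotheses (eta0 : eta != 0) (wf : forall i, w i = f i *: eta).

Lemma frame_neq0 i : f i != 0.
Proof.
apply/eqP => fi0; have := w_free (c := fun j => (j == i)%:R).
rewrite (bigD1 i) //= big1 => [|j /negPf->]; last by rewrite rmorph0 scale0r.
rewrite wf fi0 scale0r scaler0 addr0 => /(_ erefl i) /eqP.
by rewrite eqxx oner_eq0.
Qed.

Lemma frame_ratio_transcendental i j c : i != j -> f j / f i != iota c.
Proof.
move=> ij; apply/eqP => fji; have ji : (j == i) = false by rewrite eq_sym (negPf ij).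
have := w_free (c := fun l => if l == j then 1 else if l == i then - c else 0).
rewrite (bigD1 j) //= (bigD1 i) //= big1 => [|l /andP[/negPf-> /negPf->]]; last first.
  by rewrite rmorph0 scale0r.
rewrite !eqxx (negPf ij) rmorph1 rmorphN -fji !wf scale1r addr0 scaleNr scalerA.
rewrite divfK ?frame_neq0 // subrr => /(_ erefl j) /eqP.
by rewrite eqxx oner_eq0.
Qed.

Lemma frame_unique (i0 : 'I_g) (eta' : Omega) (f' : 'I_g -> K) :
  (forall i, w i = f' i *: eta') -> exists t, forall i, f i = t * f' i.
Proof.
move=> wf'; have f'0 : f' i0 != 0.
  apply/eqP => f'0; have /eqP := wf i0.
  by rewrite wf' f'0 scale0r eq_sym scaler_eq0 (negPf (frame_neq0 i0)) (negPf eta0).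
exists (f i0 / f' i0) => i; have etaE : eta' = (f i0 / f' i0) *: eta.
  by rewrite mulrC -scalerA -wf wf' scalerA mulVf // scale1r.
have /eqP := wf i; rewrite wf' etaE scalerA -subr_eq0 -scalerBl scaler_eq0.
by rewrite (negPf eta0) orbF subr_eq0 mulrC => /eqP.
Qed.

Lemma canonical_ideal_homog (i0 : 'I_g) (e : nat) (F : {mpoly k[g]}) :
  F \is e.-homog -> canonical_ideal iota w F <-> mmap iota f F = 0.
Proof.
move=> hF; split=> [[eta' [f' [_ wf']]]|Ff]; last first.
  by exists eta, f; split; rewrite // (mmap_homogX _ _ hF) Ff scale0r.
rewrite (mmap_homogX _ _ hF) => /eqP; rewrite scaler_eq0 -size_poly_eq0 size_polyXn orbF.
move=> /eqP Ff'; have [t ft] := frame_unique i0 wf'.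
have -> : mmap iota f F = mmap iota (fun i => t * f' i) F.
  by apply: eq_bigr => m _; congr (_ * _); apply: mmap1_eq => i.
by rewrite (mmap_homog_scale _ _ _ hF) Ff' mulr0.
Qed.

Lemma canonical_curve_values (O : K -> Prop) (i0 : 'I_g) (a : 'cV[k]_g) :
  a != 0 -> is_point iota O ->
  (exists2 t, t != 0 & forall i, has_value iota O (t * f i) (a i 0)) ->
  canonical_curve iota w a.
Proof.
move=> a0 hO [t t0 ha]; split=> //; exists O; split=> //.
exists (t^-1 *: eta), (fun i => t * f i) => i; split=> //.
by rewrite wf scalerA mulrAC mulfV // mul1r.
Qed.

Lemma canonical_curveP (a : 'cV[k]_g) : (1 < g)%N ->
  canonical_curve iota w a <->
  a != 0 /\ forall (e : nat) (F : {mpoly k[g]}),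
    F \is e.-homog -> mmap iota f F = 0 -> F.@[fun i => a i 0] = 0.
Proof.
move=> g1; split=> [[a0 [O [hO [eta' [h wh]]]]]|[a0 ha]].
  split=> // e F hF Ff; have i0 := Ordinal (ltnW g1).
  have hG := has_value_pplace hO.
  apply: (pplace_val0 hG (pplace_mmap F hG (fun i => (wh i).2))).
  have [_ wh'] : eta' != 0 /\ forall i, w i = h i *: eta'.
    split=> [|i]; last by case: (wh i).
    apply/eqP => eta'0; have /eqP := wf i0; have [-> _] := wh i0.
    by rewrite eta'0 scaler0 eq_sym scaler_eq0 (negPf (frame_neq0 i0)) (negPf eta0).
  have [t ft] := frame_unique i0 wh'.
  have t0 : t != 0.
    by apply: contraNneq (frame_neq0 i0) => t0; rewrite ft t0 mul0r.
  have /eqP : mmap iota (fun i => t * h i) F = 0.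
    by rewrite -Ff; apply: eq_bigr => m _; congr (_ * _); apply: mmap1_eq => i.
  by rewrite (mmap_homog_scale _ _ _ hF) mulf_eq0 expf_eq0 (negPf t0) andbF => /eqP.
have /cV0Pn[i0 ai0] := a0.
pose av i := a i 0.
pose G0 (z : K * k) := exists e (F : {mpoly k[g]}), F \is e.-homog /\
  z = (mmap iota f F / f i0 ^+ e, F.@[av] / av i0 ^+ e).
have f0 := frame_neq0 i0.
have fe n : f i0 ^+ n != 0 by rewrite expf_neq0.
have ae n : av i0 ^+ n != 0 by rewrite expf_neq0.
have homX (i : 'I_g) : ('X_i : {mpoly k[g]}) \is 1.-homog by rewrite dhomogX /= mdeg1.
have homXn (i : 'I_g) n : ('X_i ^+ n : {mpoly k[g]}) \is n.-homog.
  by have := dhomogMn n (homX i); rewrite mul1n.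
have hG0 : partial_place iota G0.
  split=> [c|_ _ [e [F [hF ->]]] [e' [F' [hF' ->]]]|[e [F [hF [Ff Fa]]]]].
  - exists 0%N, c%:MP; split; last by rewrite mmapC mevalC !divr1.
    by rewrite -[c%:MP]mulr1 mul_mpolyC; apply/dhomogZ/dhomog1.
  - split.
      exists (e + e')%N, (F * 'X_i0 ^+ e' - F' * 'X_i0 ^+ e); split.
        apply: rpredB; first exact: dhomogM.
        by rewrite addnC; apply: dhomogM.
      rewrite rmorphB !rmorphM !rmorphXn /= !mmapX !mmap1U.
      rewrite mevalB !mevalM !rmorphXn /= !mevalXU !exprD.
      by congr pair; rewrite /=; field; rewrite ?fe ?ae.
    exists (e + e')%N, (F * F'); split; first exact: dhomogM.
    rewrite rmorphM mevalM !exprD /=.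
    by congr pair; rewrite /=; field; rewrite ?fe ?ae.
  - move/esym/eqP: Ff; rewrite mulf_eq0 invr_eq0 (negPf (fe e)) orbF => /eqP Ff.
    by move/eqP: Fa; rewrite (ha _ _ hF Ff) mul0r oner_eq0.
have G0f i : G0 (f i / f i0, av i / av i0).
  by exists 1%N, 'X_i; rewrite mmapX mmap1U mevalXU.
have [i1 i01] : exists i1, i0 != i1.
  exists (if i0 == Ordinal g1 then Ordinal (ltnW g1) else Ordinal g1).
  by case: ifP => [/eqP->|->].
pose t := f i1 / f i0 - iota (av i1 / av i0).
have t0 : t != 0 by rewrite subr_eq0 frame_ratio_transcendental.
have G0t : G0 (t, 0).
  by have := pplaceB hG0 (G0f i1) (pplaceC hG0 (av i1 / av i0)); rewrite subrr.
have [O [hO G0O _]] := point_extending hG0 t0 G0t.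
apply: (@canonical_curve_values O i0) => //; exists (iota (av i0) / f i0).
  by rewrite mulf_neq0 ?invr_eq0 // fmorph_eq0.
move=> i; apply: G0O; have := pplaceM hG0 (pplaceC hG0 (av i0)) (G0f i).
by rewrite [av i0 * _]mulrC divfK // mulrA mulrAC.
Qed.

Lemma vanishing_on_canonical_curve (i0 : 'I_g) (e : nat) (F : {mpoly k[g]}) :
  function_field iota -> F \is e.-homog ->
  (forall a, canonical_curve iota w a -> F.@[fun i => a i 0] = 0) ->
  mmap iota f F = 0.
Proof.
move=> hK hF Fa; apply/eqP/negPn/negP => Ff.
pose y i := (f i0)^-1 * f i; pose u := mmap iota y F.
have f0 := frame_neq0 i0.
have u0 : u != 0.
  by rewrite /u (mmap_homog_scale _ _ _ hF) mulf_neq0 // expf_neq0 // invr_eq0.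
have [O [hO Oy vO]] := regular_point (fun o => if o is Some i then y i else u^-1) hK.
have /boolp.choice[a ha] i : exists a, has_value iota O (y i) a.
  exact: vO (Oy (Some i)).
have hG := has_value_pplace hO.
have a1 : a i0 = 1.
  apply/eqP; rewrite -subr_eq0 -oppr_eq0 opprB; apply/eqP.
  have /(pplace_val0 hG) -> // := pplaceB hG (pplace1 hG) (ha i0).
  by rewrite /y mulVf ?subrr.
have Ya : canonical_curve iota w (\col_i a i).
  apply: (@canonical_curve_values O i0) => //.
    by apply/cV0Pn; exists i0; rewrite mxE a1 oner_neq0.
  exists (f i0)^-1 => [|i]; first by rewrite invr_eq0.
  by rewrite mxE; apply: ha.
have Gu := pplace_mmap F hG ha.
have {}Fa : F.@[a] = 0.
  by rewrite -(Fa _ Ya); apply: meval_eq => i; rewrite mxE.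
have [_ []] : has_value iota O u 0 by rewrite -Fa.
  by rewrite rmorph0 subr0 => /eqP; apply/negP.
by rewrite rmorph0 subr0; apply; apply: (Oy None).
Qed.

End CanonicalCurve.

Section QuadraticForms.

Variables (k : fieldType) (g : nat).
Implicit Types (A B s : 'M[k]_g) (F : {mpoly k[g]}).

Lemma quadratic_form_sum (r : nat) (c : 'I_r -> k) (A : 'I_r -> 'M[k]_g) :
  quadratic_form (\sum_j c j *: A j) = \sum_j c j *: quadratic_form (A j).
Proof.
transitivity (\sum_mu \sum_nu \sum_j (c j * A j mu nu) *: ('X_mu * 'X_nu : {mpoly k[g]})).
  apply: eq_bigr => mu _; apply: eq_bigr => nu _.
  by rewrite summxE scaler_suml; apply: eq_bigr => j _; rewrite mxE.
under eq_bigr do rewrite exchange_big.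
rewrite exchange_big; apply: eq_bigr => j _; rewrite scaler_sumr; apply: eq_bigr => mu _.
by rewrite scaler_sumr; apply: eq_bigr => nu _; rewrite scalerA.
Qed.

Lemma quadratic_form_homog A : quadratic_form A \is 2.-homog.
Proof.
apply: rpred_sum => mu _; apply: rpred_sum => nu _; apply: rpredZ.
by rewrite -mpolyXD dhomogX /= mdegD !mdeg1.
Qed.

Lemma meval_quadratic_form A (a : 'I_g -> k) :
  (quadratic_form A).@[a] = \sum_mu \sum_nu A mu nu * (a mu * a nu).
Proof.
rewrite raddf_sum; apply: eq_bigr => mu _; rewrite raddf_sum; apply: eq_bigr => nu _.
by rewrite /= mevalZ mevalM !mevalXU.
Qed.

Lemma linear_action_quadratic_form s A :
  linear_action s (quadratic_form A) = quadratic_form (s^T *m A *m s).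
Proof.
rewrite /linear_action /quadratic_form raddf_sum /=.
transitivity (\sum_mu \sum_nu \sum_al \sum_be
    (A mu nu * (s mu al * s nu be)) *: ('X_al * 'X_be : {mpoly k[g]})).
  apply: eq_bigr => mu _; rewrite raddf_sum; apply: eq_bigr => nu _ /=.
  rewrite comp_mpolyZ rmorphM /= !comp_mpolyXU -!tnth_nth !tnth_mktuple.
  rewrite mulr_suml scaler_sumr; apply: eq_bigr => al _.
  rewrite mulr_sumr scaler_sumr; apply: eq_bigr => be _.
  by rewrite -scalerAl -scalerAr !scalerA !mulrA.
transitivity (\sum_al \sum_be \sum_nu \sum_mu
    (A mu nu * (s mu al * s nu be)) *: ('X_al * 'X_be : {mpoly k[g]})).
  rewrite exchange_big; under eq_bigr do rewrite exchange_big.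
  rewrite exchange_big; apply: eq_bigr => al _ /=.
  under eq_bigr do rewrite exchange_big.
  by rewrite exchange_big.
apply: eq_bigr => al _; apply: eq_bigr => be _.
rewrite mxE scaler_suml; apply: eq_bigr => nu _.
rewrite mxE mulr_suml scaler_suml; apply: eq_bigr => mu _.
by rewrite mxE; congr (_ *: _); ring.
Qed.

Lemma symmetric_quadratic_form_inj A B : 2%N \notin [pchar k] ->
  A^T = A -> B^T = B -> quadratic_form A = quadratic_form B -> A = B.
Proof.
move=> char2 sA sB AB; apply/matrixP => mu nu.
have two0 : 2%:R != 0 :> k by move: char2; rewrite inE /=.
pose D := A - B; have sD : D^T = D by rewrite linearB /= sA sB.
have D0 a : \sum_mu \sum_nu D mu nu * (a mu * a nu) = 0.
  transitivity ((quadratic_form A).@[a] - (quadratic_form B).@[a]); last first.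
    by rewrite AB subrr.
  rewrite !meval_quadratic_form -sumrB.
  apply: eq_bigr => i _; rewrite -sumrB; apply: eq_bigr => j _.
  by rewrite !mxE mulrBl.
have Ddelta i j (a b : 'I_g -> k) : a = (fun l => (l == i)%:R) ->
    b = (fun l => (l == j)%:R) -> \sum_mu \sum_nu D mu nu * (a mu * b nu) = D i j.
  move=> -> ->; rewrite (bigD1 i) //= [X in _ + X]big1 => [|l /negPf li]; last first.
    by apply: big1 => m _; rewrite li mul0r mulr0.
  rewrite (bigD1 j) //= [X in _ + X + _]big1 => [|l /negPf lj]; last by rewrite lj !mulr0.
  by rewrite !eqxx !mulr1 !addr0.
pose e i : 'I_g -> k := fun l => (l == i)%:R.
have Dii i : D i i = 0 by rewrite -[RHS](D0 (e i)) (Ddelta i i).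
have Dsym : D nu mu = D mu nu by rewrite -{1}sD mxE.
have : D mu nu *+ 2 = 0.
  transitivity (\sum_i \sum_j (D i j * (e mu i * e mu j) + D i j * (e mu i * e nu j) +
     (D i j * (e nu i * e mu j) + D i j * (e nu i * e nu j)))); last first.
    rewrite -[RHS](D0 (fun l => e mu l + e nu l)).
    by apply: eq_bigr => i _; apply: eq_bigr => j _; ring.
  do 3![under eq_bigr do rewrite big_split]; rewrite !big_split /=.
  rewrite !(Ddelta _ _ _ _ erefl erefl) !Dii add0r addr0 mulr2n.
  by rewrite Dsym.
move/eqP; rewrite -mulr_natr mulf_eq0 (negPf two0) orbF !mxE subr_eq0.
by move/eqP.
Qed.

Lemma homog_combination (r e : nat) (G : 'I_r -> {mpoly k[g]}) F :
  (forall i, G i \is e.-homog) -> F \is e.-homog -> generated_by G F ->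
  exists c : 'I_r -> k, F = \sum_i c i *: G i.
Proof.
move=> hG hF [c FE]; exists (fun i => (c i)@_0%MM); apply/mpolyP => m.
have [me|me] := eqVneq (mdeg m) e; last first.
  rewrite (dhomog_nemf_coeff hF me) raddf_sum big1 //= => i _.
  by rewrite mcoeffZ (dhomog_nemf_coeff (hG i) me) mulr0.
rewrite FE !raddf_sum; apply: eq_bigr => i _ /=.
rewrite -mul_mpolyC; apply/eqP; rewrite -subr_eq0 -mcoeffB -mulrBl; apply/eqP.
rewrite mcoeffM big1 // => -[m1 m2] /= /eqP mE.
have [m2e|m2e] := eqVneq (mdeg m2) e; last first.
  by rewrite (dhomog_nemf_coeff (hG i) m2e) mulr0.
have /eqP : (mdeg m1 + mdeg m2 = mdeg m2)%N by rewrite -mdegD -mE m2e.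
rewrite -{2}[mdeg m2]add0n eqn_add2r mdeg_eq0 => /eqP->.
by rewrite mcoeffB mcoeffC eqxx mulr1 subrr mul0r.
Qed.

(* Congruence by [s] is an injective endomorphism of ['M_g], so a finite-dimensional
   subspace that it maps into itself is mapped onto itself. *)
Lemma congruence_span_surjective (r : nat) (A : 'I_r -> 'M[k]_g) s (lambda : 'M[k]_r) :
  s \in unitmx ->
  (forall i, s^T *m A i *m s = \sum_j lambda j i *: A j) ->
  exists D : 'M[k]_r, forall i, A i = \sum_j D i j *: (s^T *m A j *m s).
Proof.
move=> us sA; pose B : 'M[k]_(r, g * g) := \matrix_i mxvec (A i).
pose B' : 'M[k]_(r, g * g) := \matrix_i mxvec (s^T *m A i *m s).
pose L := lin_mx (mulmxr s \o mulmx s^T) : 'M[k]_(g * g).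
pose L' := lin_mx (mulmxr (invmx s) \o mulmx (invmx s)^T) : 'M[k]_(g * g).
have BL : B *m L = B'.
  by apply/row_matrixP => i; rewrite row_mul !rowK mul_vec_lin.
have LL' : L *m L' = 1%:M.
  apply/row_matrixP => i; rewrite row_mul rowE -[delta_mx _ _]vec_mxK.
  rewrite mul_vec_lin /= mul_vec_lin /= rowE mulmx1.
  by rewrite !mulmxA -trmx_mul mulmxV // trmx1 mul1mx mulmxK // vec_mxK.
have sub : (B' <= B)%MS.
  apply/row_subP => i; rewrite rowK sA linear_sum; apply: summx_sub => j _.
  rewrite linearZ /= scalemx_sub //.
  by have := row_sub j B; rewrite rowK.
have /submxP[D BE] : (B <= B')%MS.
  have := mxrank_leqif_sup sub; rewrite /leqif -BL mxrankMfree ?eqxx; first by case.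
  by apply/row_freeP; exists L'.
exists D => i; apply: (can_inj mxvecK).
have := congr1 (row i) BE; rewrite rowK row_mul mulmx_sum_row => ->.
rewrite linear_sum; apply: eq_bigr => j _.
by rewrite rowK linearZ mxE.
Qed.

End QuadraticForms.

Section LinearMaps.

Variables (k : fieldType) (g : nat).

Lemma meval_linear_action (s : 'M[k]_g) (F : {mpoly k[g]}) (a : 'cV[k]_g) :
  (linear_action s F).@[fun i => a i 0] = F.@[fun i => (s *m a) i 0].
Proof.
rewrite /linear_action comp_mpoly_meval; apply: meval_eq => i.
rewrite tnth_mktuple raddf_sum mxE; apply: eq_bigr => j _.
by rewrite /= mevalZ mevalXU.
Qed.

Lemma mulmx_unit_neq0 (s : 'M[k]_g) (a : 'cV[k]_g) :
  s \in unitmx -> a != 0 -> s *m a != 0.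
Proof.
by move=> us; apply: contraNneq => sa; rewrite -(mulKmx us a) sa mulmx0.
Qed.

Lemma linear_projective_morphism (Y : 'cV[k]_g -> Prop) (s : 'M[k]_g) :
  s \in unitmx -> (forall a, Y a -> a != 0) -> (forall a, Y a -> Y (s *m a)) ->
  projective_morphism Y Y (fun a => s *m a).
Proof.
move=> us Y0 Ys a Ya; split; first exact: Ys.
pose F i : {mpoly k[g]} := \sum_j s i j *: 'X_j.
have FE b : eval_forms F b = s *m b.
  apply/colP => i; rewrite !mxE raddf_sum; apply: eq_bigr => j _.
  by rewrite /= mevalZ mevalXU.
exists 1%N, F; split=> [i||b _ _]; last by rewrite FE; exists 1; rewrite ?oner_neq0 ?scale1r.
  by apply: rpred_sum => j _; apply: rpredZ; rewrite dhomogX /= mdeg1.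
by rewrite FE; apply: mulmx_unit_neq0 => //; apply: Y0.
Qed.

End LinearMaps.

Unset Implicit Arguments.

Theorem proposition4
  (k : closedFieldType) (hchar : 2%N \notin [pchar k])
  (K : fieldType) (iota : {rmorphism k -> K})
  (hK : function_field iota)
  (hnh : ~ hyperelliptic iota)
  (Omega : lmodType K) (d : K -> Omega) (hd : is_kaehler iota d)
  (g : nat) (hg : (3 <= g)%N)
  (w : 'I_g -> Omega) (hw : holomorphic_basis iota d w)
  (r : nat) (A : 'I_r -> 'M[k]_g) (hA : forall i, (A i)^T = A i)
  (hI : forall F : {mpoly k[g]},
     canonical_ideal iota w F <-> generated_by (fun i => quadratic_form (A i)) F)
  (s : 'M[k]_g) (hs : s \in unitmx) :
  (gives_automorphism iota w s <->
   exists lambda : 'M[k]_r, forall i : 'I_r,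
     linear_action s (quadratic_form (A i)) =
     \sum_(j < r) lambda j i *: quadratic_form (A j))
  /\
  (forall lambda : 'M[k]_r,
     (forall i : 'I_r,
        linear_action s (quadratic_form (A i)) =
        \sum_(j < r) lambda j i *: quadratic_form (A j)) <->
     (forall i : 'I_r,
        s^T *m A i *m s = \sum_(j < r) lambda j i *: A j)).
Proof.
have forms_matrices (lambda : 'M[k]_r) :
    (forall i : 'I_r, linear_action s (quadratic_form (A i)) =
       \sum_(j < r) lambda j i *: quadratic_form (A j)) <->
    (forall i : 'I_r, s^T *m A i *m s = \sum_(j < r) lambda j i *: A j).
  split=> sA i; last by rewrite linear_action_quadratic_form sA quadratic_form_sum.
  apply: symmetric_quadratic_form_inj => //.
  - by rewrite !trmx_mul trmxK hA mulmxA.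
  - by rewrite linear_sum; apply: eq_bigr => j _; rewrite linearZ /= hA.
  - by rewrite -linear_action_quadratic_form quadratic_form_sum.
split=> //.
have g1 : (1 < g)%N := ltnW hg.
have i0 : 'I_g := Ordinal (ltnW g1).
have w_free : forall c : 'I_g -> k,
    \sum_(i < g) iota (c i) *: w i = 0 -> forall i, c i = 0 by case: hw.
have [eta [f [eta0 wf _]]] : canonical_ideal iota w 0.
  by apply/hI; exists (fun=> 0); rewrite big1 // => i _; rewrite mul0r.
have idealP := canonical_ideal_homog w_free eta0 wf i0.
have gens i : mmap iota f (quadratic_form (A i)) = 0.
  apply/(idealP _ _ (quadratic_form_homog (A i)))/hI.
  exists (fun j => (j == i)%:R); rewrite (bigD1 i) //= eqxx mul1r big1 ?addr0 //.
  by move=> j /negPf->; rewrite mul0r.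
have curveP (a : 'cV[k]_g) : canonical_curve iota w a <->
    a != 0 /\ forall i, (quadratic_form (A i)).@[fun j => a j 0] = 0.
  rewrite (canonical_curveP w_free eta0 wf a g1); split=> -[a0 ha]; split=> //.
    by move=> i; apply: ha (quadratic_form_homog (A i)) (gens i).
  move=> e F /idealP FP /FP/hI[c ->]; rewrite raddf_sum big1 // => i _.
  by rewrite /= mevalM ha mulr0.
split=> [[sY _]|[lambda sA]].
  have comb i : exists c : 'I_r -> k, linear_action s (quadratic_form (A i)) =
      \sum_j c j *: quadratic_form (A j).
    have hF : linear_action s (quadratic_form (A i)) \is 2.-homog.
      by rewrite linear_action_quadratic_form quadratic_form_homog.
    apply: (homog_combination _ hF) => [j|]; first exact: quadratic_form_homog.
    apply/hI/(idealP _ _ hF); apply: (vanishing_on_canonical_curve w_free wf i0 hK hF).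
    by move=> a /sY[/curveP[_ Qsa] _]; rewrite meval_linear_action.
  have [c hc] := boolp.choice comb.
  by exists (\matrix_(j, i) c i j) => i; rewrite hc; apply: eq_bigr => j _; rewrite mxE.
have Y0 a : canonical_curve iota w a -> a != 0 by case.
have Ys a : canonical_curve iota w a -> canonical_curve iota w (s *m a).
  move=> /curveP[a0 Qa]; apply/curveP; split=> [|i]; first exact: mulmx_unit_neq0.
  rewrite -meval_linear_action sA raddf_sum big1 // => j _.
  by rewrite /= mevalZ Qa mulr0.
have [D AD] := congruence_span_surjective hs ((forms_matrices lambda).1 sA).
have Ys' a : canonical_curve iota w a -> canonical_curve iota w (invmx s *m a).
  move=> /curveP[a0 Qa]; apply/curveP; split=> [|i].
    by apply: mulmx_unit_neq0; rewrite ?unitmx_inv.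
  rewrite AD quadratic_form_sum raddf_sum big1 // => j _.
  by rewrite /= mevalZ -linear_action_quadratic_form meval_linear_action mulKVmx // Qa mulr0.
split; first exact: linear_projective_morphism.
exists (fun a => invmx s *m a); split.
  by apply: linear_projective_morphism; rewrite ?unitmx_inv.
by move=> a _; rewrite mulKmx // mulKVmx //; split; exists 1; rewrite ?oner_neq0 ?scale1r.
Qed.
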